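(* Let $D$ be a weakly successively almost positive diagram and let $(D=D_+,D_0,D_-)$ be its standard skein triple. Then both $D_-$ and $D_0$ are weakly successively almost positive diagrams, and $\mathcal{C}(D_0)<\mathcal{C}(D)$ and $\mathcal{C}(D_-)<\mathcal{C}(D)$ in the lexicographic order.
   Context: Link diagrams are oriented. An overarc of a diagram is a subarc of a component that meets crossings in its interior only as overpasses. A diagram $D$ is weakly successively $k$-almost positive ($k\ge 0$) if exactly $k$ crossings of $D$ are negative, all others are positive, and the overpasses of all $k$ negative crossings lie (not necessarily consecutively) on a single overarc, called the negative overarc; it is weakly successively almost positive if this holds for some $k\ge0$. Such a diagram is regarded as equipped with its negative overarc; the component containing it is taken to be the first component, with base point near the initial point of the negative overarc. The standard skein triple of $D$: let $c$ be the positive crossing that terminates the negative overarc, i.e. the positive crossing at which, walking along the orientation from the base point, the negative overarc ends because the walk passes $c$ as an underpass, $c$ being met there for the first time. Then $D_+=D$, $D_-$ is obtained by changing $c$ to a negative crossing, and $D_0$ is obtained by the orientation-respecting smoothing of $c$. In $D_-$ the negative overarc is the old one extended over $c$; in $D_0$ it is the old one (continued through the smoothing). The complexity of a weakly successively almost positive diagram is $\mathcal{C}(D)=(c(D),\,c(D)-\ell(D))$, ordered lexicographically, where $c(D)$ is the number of crossings and $\ell(D)$ is the number of crossings lying on the negative overarc. *)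

(* Defs.v *)
From mathcomp Require Import all_boot all_order all_fingroup.

Set Implicit Arguments.
Unset Strict Implicit.
Unset Printing Implicit Defensive.

(* Oriented link diagrams, as signed Gauss data on a finite set of edges.

   The diagram is cut at finitely many vertices into oriented edges.  A vertex
   is either a crossing or a "plain" point, lying on one strand only; plain
   points carry no information, but allow components without crossings (a
   circle is then an edge e with follow e = e, or a longer cycle of edges) and
   stay behind when a crossing is smoothed.

   [follow e] is the edge that follows e along the orientation.  A passage of a
   strand through a vertex is named by its incoming edge: the crossing x is
   passed by the edge [over_in x], continued by [follow (over_in x)], as an
   overpass, and by [under_in x], continued by [follow (under_in x)], as an
   underpass. *)
Record gauss_data := GaussData {
  edge : finType;
  follow : {perm edge};
  crossing : finType;
  over_in : crossing -> edge;
  under_in : crossing -> edge;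
  positive : crossing -> bool }.

Arguments follow : clear implicits.
Arguments over_in : clear implicits.
Arguments under_in : clear implicits.
Arguments positive : clear implicits.

Definition proper_passages (D : gauss_data) : Prop :=
  [/\ injective (over_in D), injective (under_in D)
    & forall x y, over_in D x <> under_in D y].

(* The edge e ends at a plain point. *)
Definition plain (D : gauss_data) (e : edge D) : bool :=
  [forall x, (e != over_in D x) && (e != under_in D x)].

(* Drawn with both strands pointing upwards, a positive crossing has its
   overpass running from bottom left to top right, a negative one from bottom
   right to top left.  [left_in] and [right_in] are the two lower edges. *)
Definition left_in (D : gauss_data) (x : crossing D) : edge D :=
  if positive D x then over_in D x else under_in D x.
Definition right_in (D : gauss_data) (x : crossing D) : edge D :=
  if positive D x then under_in D x else over_in D x.

(* Traversing the edge e forwards (e, true) or backwards (e, false), turn left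
   at the vertex reached.  The orbits are the boundary cycles of the faces, each
   face lying on the left.  In the drawing above, the upper right edge of x is
   [follow (left_in x)] and the upper left one is [follow (right_in x)]. *)
Definition turn_left (D : gauss_data) (d : edge D * bool) : edge D * bool :=
  let: (e, forwards) := d in
  if forwards then
    if [pick x | left_in x == e] is Some x then (follow D (right_in x), true)
    else if [pick x | right_in x == e] is Some x then (left_in x, false)
    else (follow D e, true)
  else
    let e' := (follow D)^-1%g e in
    if [pick x | right_in x == e'] is Some x then (follow D (left_in x), true)
    else if [pick x | left_in x == e'] is Some x then (right_in x, false)
    else (e', false).

Definition adjacent (D : gauss_data) : rel (edge D) := fun e f =>
  [|| f == follow D e, e == follow D f
    | [exists x, ((e == over_in D x) && (f == under_in D x))
              || ((f == over_in D x) && (e == under_in D x))]].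

Definition n_vertices (D : gauss_data) : nat :=
  #|crossing D| + #|[set e : edge D | plain e]|.
Definition n_faces (D : gauss_data) : nat := fcard (@turn_left D) predT.
Definition n_pieces (D : gauss_data) : nat := n_comp (@adjacent D) predT.

(* Euler's formula V - E + F = 2K, where K is the number of connected pieces of
   the underlying graph and the faces are counted piece by piece: every piece
   has genus 0.  How the pieces of a split diagram are placed relative to each
   other in the plane is not recorded; nothing below depends on it. *)
Definition planar (D : gauss_data) : Prop :=
  n_vertices D + n_faces D = #|edge D| + 2 * n_pieces D.

Definition link_diagram (D : gauss_data) : Prop :=
  proper_passages D /\ planar D.

(* A subarc of a component, starting inside the edge [base] (where the base
   point is) and running through [steps] vertices. *)
Record marked_diagram := MarkedDiagram {
  diagram :> gauss_data;
  base : edge diagram;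
  steps : nat }.

Arguments base : clear implicits.

(* The passages on the arc, in the order of the walk from the base point. *)
Definition arc_passages (D : marked_diagram) : seq (edge D) :=
  traject (follow D) (base D) (steps D).

(* The edge inside which the arc stops. *)
Definition arc_end (D : marked_diagram) : edge D :=
  iter (steps D) (follow D) (base D).

(* [uniq]: the arc does not run over any part of its component twice. *)
Definition is_overarc (D : marked_diagram) : Prop :=
  uniq (arc_passages D) /\ forall x, under_in D x \notin arc_passages D.

Definition weakly_successively_k_almost_positive
    (k : nat) (D : marked_diagram) : Prop :=
  [/\ link_diagram D, is_overarc D,
      #|[set x : crossing D | ~~ positive D x]| = k
    & forall x, ~~ positive D x -> over_in D x \in arc_passages D].

Definition weakly_successively_almost_positive (D : marked_diagram) : Prop :=
  exists k, weakly_successively_k_almost_positive k D.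

Definition on_arc (D : marked_diagram) (x : crossing D) : bool :=
  (over_in D x \in arc_passages D) || (under_in D x \in arc_passages D).

Definition n_crossings (D : gauss_data) : nat := #|crossing D|.
Definition n_arc_crossings (D : marked_diagram) : nat :=
  #|[set x : crossing D | on_arc x]|.

(* [*l] is the product with the lexicographic order; the subtraction never
   truncates, since n_arc_crossings D <= n_crossings D. *)
Definition complexity (D : marked_diagram) : nat *l nat :=
  (n_crossings D, n_crossings D - n_arc_crossings D).

Definition change_crossing (D : gauss_data) (c : crossing D) : gauss_data :=
  {| edge := edge D;
     follow := follow D;
     crossing := crossing D;
     over_in := fun x => if x == c then under_in D x else over_in D x;
     under_in := fun x => if x == c then over_in D x else under_in D x;
     positive := fun x => if x == c then ~~ positive D x else positive D x |}.

(* The incoming edge of each strand at c is continued by the outgoing edge of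
   the other one, and c is replaced by two plain points. *)
Definition smooth_crossing (D : gauss_data) (c : crossing D) : gauss_data :=
  {| edge := edge D;
     follow := (tperm (over_in D c) (under_in D c) * follow D)%g;
     crossing := {x : crossing D | x != c};
     over_in := fun x => over_in D (val x);
     under_in := fun x => under_in D (val x);
     positive := fun x => positive D (val x) |}.

(* After the end of the arc, the first crossing met is c; it is positive, is
   passed there as an underpass, and was not met on the arc. *)
Definition terminates (D : marked_diagram) (c : crossing D) : Prop :=
  [/\ positive D c, ~~ on_arc c
    & exists2 m, all (@plain D) (traject (follow D) (arc_end D) m)
               & iter m (follow D) (arc_end D) = under_in D c].

(* The number of steps from the base point through the vertex at which the walk
   along D arrives by [under_in c]. *)
Definition steps_through (D : marked_diagram) (c : crossing D) : nat :=
  (findex (follow D) (base D) (under_in D c)).+1.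

(* D_-, with the arc extended over c. *)
Definition skein_minus (D : marked_diagram) (c : crossing D) : marked_diagram :=
  @MarkedDiagram (change_crossing c) (base D) (steps_through c).

(* D_0, with the arc continued through the smoothing of c. *)
Definition skein_zero (D : marked_diagram) (c : crossing D) : marked_diagram :=
  @MarkedDiagram (smooth_crossing c) (base D) (steps_through c).

Definition standard_skein_triple (Dplus Dzero Dminus : marked_diagram) : Prop :=
  exists c : crossing Dplus,
    [/\ terminates c, Dzero = skein_zero c & Dminus = skein_minus c].

(* Main.v *)
(* The walk from the base point along the old arc, then through plain points, and
   finally under c, meets no vertex twice and no other underpass.  So it is an
   overarc once c is changed or smoothed, and it has gained c in the first case.

   The work is in the planarity of D_0.  Smoothing c turns the permutation whose
   cycles are the faces into its product with a transposition, so the number F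
   of faces changes by one, up or down, while V increases by one and the number K
   of pieces by at most one.  If the smoothing disconnects the two strands at c,
   no face meets both, so F goes up.  By induction on the crossings, smoothing
   them one after the other, this gives V + F <= E + 2K for every Gauss diagram,
   planar or not.  Applied to D_0, the inequality forces K to go up whenever F
   does, so V - E + F = 2K persists. *)

Require Import Defs.
From mathcomp Require Import all_boot all_order all_fingroup.
From mathcomp Require Import zify.

Set Implicit Arguments.
Unset Strict Implicit.
Unset Printing Implicit Defensive.

(** * Orbits of a map and components of a relation *)

(** Were the orbit of [x] exhausted within [n] steps, the first [n] iterates would list all of it,
    the [n]-th iterate included. *)
Lemma iter_traject_lt (T : finType) (f : T -> T) x n :
  iter n f x \notin traject f x n -> n < fingraph.order f x.
Proof.
apply: contraR; rewrite -leqNgt => le_n.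
have /trajectP[i lt_i ->] : iter n f x \in fingraph.orbit f x.
  by rewrite -fconnect_orbit fconnect_iter.
by apply/trajectP; exists i => //; exact: leq_trans lt_i le_n.
Qed.

Lemma eq_traject (T : eqType) (f g : T -> T) x n :
  {in traject f x n.-1, f =1 g} -> traject f x n = traject g x n.
Proof.
elim: n x => [|[|n] IHn] x //= fg.
have <- : f x = g x by apply: fg; rewrite inE eqxx.
congr (_ :: _); apply: (IHn (f x)) => y y_in; apply: fg.
by rewrite inE y_in orbT.
Qed.

Lemma fcard_perm (T : finType) (s : {perm T}) : fcard s predT = #|porbits s|.
Proof.
have mem_porbit_fconnect x y : (y \in porbit s x) = fconnect s x y.
  apply/porbitP/idP => [[i ->]|]; first by rewrite permX fconnect_iter.
  by move/iter_findex <-; exists (findex s x y); rewrite permX.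
have porbit_root x : porbit s (froot s x) = porbit s x.
  apply/eqP; rewrite eq_porbit_mem mem_porbit_fconnect; exact: connect_root.
have sym_s := fconnect_sym (@perm_inj _ s).
rewrite /n_comp_mem /porbits.
rewrite -(@card_in_imset _ _ (porbit s) [predI froots s & predT]) => [|x y].
  apply: eq_card => A; apply/imsetP/imsetP => [[x _ ->]|[x _ ->]].
    by exists x.
  exists (froot s x); last by rewrite porbit_root.
  by rewrite !inE (roots_root sym_s).
rewrite !inE !andbT => /eqP rx /eqP ry /eqP.
rewrite eq_porbit_mem mem_porbit_fconnect -(root_connect sym_s).
by rewrite rx ry => /eqP.
Qed.

(** A transposition splits a cycle containing both [a] and [b], and merges two different ones. The
    doubled boolean expresses the change by plus or minus one without subtraction. *)
Lemma fcard_comp_tperm (T : finType) (f g : T -> T) (a b : T) :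
  injective f -> a != b -> g =1 f \o tperm a b ->
  fcard g predT + (~~ fconnect f b a).*2 = (fcard f predT).+1.
Proof.
move=> f_inj ab gE; pose s := perm f_inj.
have sE : s =1 f by exact: permE.
have -> : fcard g predT = #|porbits (tperm a b * s)%g|.
  rewrite -fcard_perm; apply: eq_n_comp; apply: eq_connect => x y.
  by rewrite /frel /= permM sE gE.
have fE : fconnect f =2 fconnect s.
  by apply: eq_connect => x y; rewrite /frel /= sE.
rewrite (eq_n_comp fE) fcard_perm -addn1 fE.
have := porbits_mul_tperm s a b; rewrite /= ab => <-.
congr (_ + (~~ _).*2); apply/idP/porbitP => [/iter_findex <-|[i ->]].
  by exists (findex s b a); rewrite permX.
by rewrite permX fconnect_iter.
Qed.

(** Besides [e']-paths, an [e]-step needs at most one link between [a] and [b], and cutting a single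
    link breaks at most one component in two. *)
Lemma n_comp_add_edge (T : finType) (e e' : rel T) (a b : T) :
  connect_sym e -> connect_sym e' ->
  (forall x y, e x y ->
     [|| connect e' x y, connect e' x a && connect e' b y
       | connect e' x b && connect e' a y]) ->
  n_comp e' predT <= (n_comp e predT).+1.
Proof.
move=> sym_e sym_e' ee'.
(* cls glues the e'-components of a and b; it is constant on e-components and
   injective on the e'-roots other than that of b. *)
pose cls x := if root e' x == root e' b then root e' a else root e' x.
have cls_edge x y : e x y -> cls x = cls y.
  case/ee'/or3P => [|/andP[]|/andP[]]; rewrite -!(root_connect sym_e') /cls.
  - by move/eqP->.
  - by move=> /eqP-> /eqP<-; rewrite eqxx; case: ifP.
  - by move=> /eqP-> /eqP<-; rewrite eqxx; case: ifP.
have cls_connect x y : connect e x y -> cls x = cls y.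
  case/connectP=> p; elim: p x => [|z p IHp] x /= => [_ ->|] //.
  by case/andP=> /cls_edge-> /IHp; apply.
have -> : n_comp e' predT = #|[set x | roots e' x]|.
  by apply: eq_card => x; rewrite !inE andbT.
have -> : n_comp e predT = #|[set x | roots e x]|.
  by apply: eq_card => x; rewrite !inE andbT.
rewrite (cardsD1 (root e' b)) -add1n leq_add ?leq_b1 //.
rewrite -(@card_in_imset _ _ (root e)) => [|x y].
  apply: subset_leq_card; apply/subsetP => _ /imsetP[x _ ->].
  by rewrite inE roots_root.
rewrite !inE => /andP[xb /eqP rx] /andP[yb /eqP ry] /eqP.
rewrite root_connect // => /cls_connect.
by rewrite /cls rx ry (negbTE xb) (negbTE yb).
Qed.

(** * Left turns at crossings and plain points *)

Section Passages.
Variable D : gauss_data.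
Hypothesis D_proper : proper_passages D.
Local Notation f := (follow D).
Implicit Types (x y : crossing D) (e : edge D).

Lemma left_in_inj : injective (@left_in D).
Proof.
case: D_proper => o_inj u_inj ou x y; rewrite /left_in.
case: (positive D x); case: (positive D y) => E; first exact: o_inj.
- by case: (ou _ _ E).
- by case: (ou _ _ (esym E)).
exact: u_inj.
Qed.

Lemma right_in_inj : injective (@right_in D).
Proof.
case: D_proper => o_inj u_inj ou x y; rewrite /right_in.
case: (positive D x); case: (positive D y) => E; first exact: u_inj.
- by case: (ou _ _ (esym E)).
- by case: (ou _ _ E).
exact: o_inj.
Qed.

(** Equal signs would identify an overpass with an underpass. Opposite signs would identify two
    passages of the same kind, hence the crossings, against their signs. *)
Lemma left_in_neq_right_in x y : (left_in x == right_in y :> edge D) = false.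
Proof.
case: D_proper => o_inj u_inj ou; apply/eqP; rewrite /left_in /right_in.
case Dx: (positive D x); case Dy: (positive D y) => E.
- by case: (ou _ _ E).
- by move/o_inj: E => E; rewrite E Dy in Dx.
- by move/u_inj: E => E; rewrite E Dy in Dx.
by case: (ou _ _ (esym E)).
Qed.

Lemma plainE e :
  plain e = [forall x, (e != left_in x :> edge D) && (e != right_in x)].
Proof.
apply: eq_forallb => x; rewrite /left_in /right_in.
by case: (positive D x); rewrite // andbC.
Qed.

Variant edge_spec : edge D -> Type :=
  | EdgeLeft x : edge_spec (left_in x)
  | EdgeRight x : edge_spec (right_in x)
  | EdgePlain e of plain e : edge_spec e.

Lemma edgeP e : edge_spec e.
Proof.
case: (pickP (fun x => left_in x == e)) => [x /eqP<-|nl].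
  exact: EdgeLeft.
case: (pickP (fun x => right_in x == e)) => [x /eqP<-|nr].
  exact: EdgeRight.
apply: EdgePlain; rewrite plainE; apply/forallP => x.
by rewrite !(eq_sym e) nl nr.
Qed.

Lemma pick_left x : [pick y | left_in y == left_in x :> edge D] = Some x.
Proof.
by case: pickP => [y /eqP/left_in_inj->|/(_ x)] //; rewrite eqxx.
Qed.

Lemma pick_right x : [pick y | right_in y == right_in x :> edge D] = Some x.
Proof.
by case: pickP => [y /eqP/right_in_inj->|/(_ x)] //; rewrite eqxx.
Qed.

Lemma pick_left_right x : [pick y | left_in y == right_in x :> edge D] = None.
Proof. by case: pickP => [y|] //; rewrite left_in_neq_right_in. Qed.

Lemma pick_right_left x : [pick y | right_in y == left_in x :> edge D] = None.
Proof. by case: pickP => [y|] //; rewrite eq_sym left_in_neq_right_in. Qed.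

Lemma pick_left_plain e : plain e -> [pick y | left_in y == e :> edge D] = None.
Proof.
rewrite plainE => /forallP pe; case: pickP => [y /eqP E|] //.
by have := pe y; rewrite E eqxx.
Qed.

Lemma pick_right_plain e :
  plain e -> [pick y | right_in y == e :> edge D] = None.
Proof.
rewrite plainE => /forallP pe; case: pickP => [y /eqP E|] //.
by have := pe y; rewrite E eqxx andbF.
Qed.

(** The four corners of a crossing and the two sides of a plain point. Edges run backwards are
    written [f e], so that the vertex they reach is again named by an incoming edge. *)
Lemma turn_left_in x : turn_left (left_in x, true) = (f (right_in x), true).
Proof. by rewrite /= pick_left. Qed.

Lemma turn_right_in x : turn_left (right_in x, true) = (left_in x, false).
Proof. by rewrite /= pick_left_right pick_right. Qed.

Lemma turn_plain e : plain e -> turn_left (e, true) = (f e, true).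
Proof. by move=> pe; rewrite /= pick_left_plain // pick_right_plain. Qed.

Lemma turn_left_in_back x :
  turn_left (f (left_in x), false) = (right_in x, false).
Proof. by rewrite /= permK pick_right_left pick_left. Qed.

Lemma turn_right_in_back x :
  turn_left (f (right_in x), false) = (f (left_in x), true).
Proof. by rewrite /= permK pick_right. Qed.

Lemma turn_plain_back e : plain e -> turn_left (f e, false) = (e, false).
Proof. by move=> pe; rewrite /= permK pick_left_plain // pick_right_plain. Qed.

Definition turnE :=
  (turn_left_in, turn_right_in, turn_left_in_back, turn_right_in_back).

Lemma adjacent_sym : symmetric (@adjacent D).
Proof.
move=> x y; rewrite /adjacent orbCA; congr [|| _, _ | _].
by apply: eq_existsb => z; rewrite orbC.
Qed.

Lemma connect_adjacent_sym : connect_sym (@adjacent D).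
Proof. exact: sym_connect_sym adjacent_sym. Qed.

Lemma connect_follow e : connect (@adjacent D) e (f e).
Proof. by apply: connect1; rewrite /adjacent eqxx. Qed.

Lemma connect_left_right x : connect (@adjacent D) (left_in x) (right_in x).
Proof.
apply: connect1; apply/or3P; constructor 3; apply/existsP; exists x.
by rewrite /left_in /right_in; case: ifP; rewrite !eqxx ?orbT.
Qed.

(** This is what confines each face to a single piece. *)
Lemma connect_turn_left d : connect (@adjacent D) d.1 (turn_left d).1.
Proof.
case: d => e [].
  case: (edgeP e) => [x|x|{}e pe]; rewrite ?turnE ?turn_plain //=.
  - exact: connect_trans (connect_left_right x) (connect_follow _).
  - by rewrite connect_adjacent_sym connect_left_right.
  exact: connect_follow.
have cf e0 : connect (@adjacent D) (f e0) e0.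
  by rewrite connect_adjacent_sym connect_follow.
rewrite -[e](permKV f).
case: (edgeP ((follow D)^-1%g e)) => [x|x|{}e pe].
- rewrite turn_left_in_back.
  exact: connect_trans (cf _) (connect_left_right x).
- rewrite turn_right_in_back; apply: connect_trans (cf _) _.
  apply: connect_trans (connect_follow _).
  by rewrite connect_adjacent_sym connect_left_right.
by rewrite turn_plain_back // cf.
Qed.

Lemma fconnect_turn_left d d' :
  fconnect (@turn_left D) d d' -> connect (@adjacent D) d.1 d'.1.
Proof.
move/iter_findex <-; elim: (findex _ _ _) => //= n IHn.
exact: connect_trans IHn (connect_turn_left _).
Qed.

End Passages.

(** * Faces and pieces of a smoothed diagram *)

Section Smoothing.
Variables (D : gauss_data) (c : crossing D).
Hypothesis D_proper : proper_passages D.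
Let S := smooth_crossing c.
Let L : edge D := left_in c.
Let R : edge D := right_in c.
Local Notation f := (follow D).
Implicit Types (x y : crossing D) (e : edge D).

Lemma smooth_proper : proper_passages S.
Proof.
case: D_proper => o_inj u_inj ou; split.
- by move=> x y /o_inj /val_inj.
- by move=> x y /u_inj /val_inj.
by move=> x y; apply: ou.
Qed.

Lemma follow_smoothE e : follow S e = f (tperm L R e).
Proof.
rewrite /= permM /L /R /left_in /right_in.
by case: (positive D c); rewrite // tpermC.
Qed.

Lemma follow_smooth_left : follow S L = f R.
Proof. by rewrite follow_smoothE tpermL. Qed.

Lemma follow_smooth_right : follow S R = f L.
Proof. by rewrite follow_smoothE tpermR. Qed.

Lemma follow_smooth_other e : e != L -> e != R -> follow S e = f e.
Proof. by move=> eL eR; rewrite follow_smoothE tpermD 1?eq_sym. Qed.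

Lemma plain_smooth e :
  plain (e : edge S) = [|| e == L, e == R | plain (e : edge D)].
Proof.
have SD : @left_in S =1 @left_in D \o val by [].
have SD' : @right_in S =1 @right_in D \o val by [].
case: (boolP (e == L)) => [/eqP->|eL] /=.
  rewrite plainE; apply/forallP => x; rewrite SD SD' /=.
  rewrite (left_in_neq_right_in D_proper) (inj_eq (left_in_inj D_proper)).
  by rewrite eq_sym (valP x).
case: (boolP (e == R)) => [/eqP->|eR] /=.
  rewrite plainE; apply/forallP => x; rewrite SD SD' /=.
  rewrite [R == _]eq_sym (left_in_neq_right_in D_proper).
  by rewrite (inj_eq (right_in_inj D_proper)) eq_sym (valP x).
rewrite !plainE; apply/forallP/forallP => H x; last exact: H (val x).
have [->|xc] := eqVneq x c; first by rewrite eL.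
exact: H (Sub x xc).
Qed.

Let LR : (L == R) = false. Proof. exact: left_in_neq_right_in. Qed.

Lemma follow_smooth_left_in (x : crossing S) :
  follow S (left_in x) = f (left_in (val x)).
Proof.
apply: follow_smooth_other; last by rewrite (left_in_neq_right_in D_proper).
by rewrite (inj_eq (left_in_inj D_proper)) (valP x).
Qed.

Lemma follow_smooth_right_in (x : crossing S) :
  follow S (right_in x) = f (right_in (val x)).
Proof.
apply: follow_smooth_other; last first.
  by rewrite (inj_eq (right_in_inj D_proper)) (valP x).
by rewrite eq_sym (left_in_neq_right_in D_proper).
Qed.

(* Only the boundaries of the faces below and above c take another turn: they
   arrive along R, resp. against the edge following R, and exchange their
   continuations. *)
Lemma turn_left_smooth :
  @turn_left S =1 @turn_left D \o tperm (R, true) (f R, false).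
Proof.
have S_proper := smooth_proper.
case=> e []; rewrite /comp.
  case: (edgeP (e : edge S)) => [x|x|{}e].
  - rewrite (turn_left_in S_proper) follow_smooth_right_in tpermD.
    + by rewrite (turn_left_in D_proper).
    + by rewrite xpair_eqE eq_sym (left_in_neq_right_in D_proper).
    by rewrite xpair_eqE andbF.
  - rewrite (turn_right_in S_proper) tpermD.
    + by rewrite (turn_right_in D_proper).
    + rewrite xpair_eqE (inj_eq (right_in_inj D_proper)) eq_sym.
      by rewrite (negbTE (valP x)).
    by rewrite xpair_eqE andbF.
  move=> pe; rewrite turn_plain //; move: pe; rewrite plain_smooth.
  have [->|eR] := eqVneq e R.
    by rewrite tpermL (turn_right_in_back D_proper) follow_smooth_right.
  rewrite tpermD; last 2 first.
  - by rewrite xpair_eqE eq_sym (negbTE eR).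
  - by rewrite xpair_eqE andbF.
  have [->|eL] := eqVneq e L.
    by rewrite (turn_left_in D_proper) follow_smooth_left.
  by move=> pe; rewrite follow_smooth_other // turn_plain.
rewrite -[e](permKV (follow S)).
case: (edgeP ((follow S)^-1%g e)) => [x|x|{}e pe].
- rewrite (turn_left_in_back S_proper) follow_smooth_left_in tpermD.
  + by rewrite (turn_left_in_back D_proper).
  + by rewrite xpair_eqE andbF.
  rewrite xpair_eqE (inj_eq perm_inj) eq_sym.
  by rewrite (left_in_neq_right_in D_proper).
- rewrite (turn_right_in_back S_proper) follow_smooth_right_in.
  rewrite follow_smooth_left_in tpermD.
  + by rewrite (turn_right_in_back D_proper).
  + by rewrite xpair_eqE andbF.
  rewrite xpair_eqE (inj_eq perm_inj) (inj_eq (right_in_inj D_proper)).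
  by rewrite eq_sym (negbTE (valP x)).
rewrite turn_plain_back //; move: pe; rewrite plain_smooth.
have [->|eL] := eqVneq e L.
  by rewrite follow_smooth_left tpermR (turn_right_in D_proper).
have [->|eR] := eqVneq e R.
  rewrite follow_smooth_right tpermD.
  - by rewrite (turn_left_in_back D_proper).
  - by rewrite xpair_eqE andbF.
  by rewrite xpair_eqE (inj_eq perm_inj) eq_sym LR.
move=> pe; rewrite follow_smooth_other // tpermD.
- by rewrite turn_plain_back.
- by rewrite xpair_eqE andbF.
by rewrite xpair_eqE (inj_eq perm_inj) eq_sym (negbTE eR).
Qed.

(** One crossing is lost, and [L] and [R] now end at two new plain points. *)
Lemma n_vertices_smooth : n_vertices S = (n_vertices D).+1.
Proof.
rewrite /n_vertices /= card_sub.
have -> : [set e : edge S | plain e]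
    = L |: (R |: [set e : edge D | plain e]).
  by apply/setP => e; rewrite !inE plain_smooth.
rewrite !cardsU1 !inE LR /=.
have -> : plain L = false.
  rewrite plainE; apply/negP => /forallP/(_ c); by rewrite eqxx.
have -> : plain R = false.
  rewrite plainE; apply/negP => /forallP/(_ c); by rewrite eqxx andbF.
rewrite (cardC1 c).
have : 0 < #|crossing D| by apply/card_gt0P; exists c.
by case: #|crossing D| => // n _; rewrite /= !addnS !addSn.
Qed.

(** Stated from [S] back to [D], to serve an induction that removes crossings. *)
Lemma turn_left_smooth_inj :
  injective (@turn_left S) -> injective (@turn_left D).
Proof.
move=> S_inj.
have DE : @turn_left D =1 @turn_left S \o tperm (R, true) (f R, false).
  by move=> d; rewrite /comp turn_left_smooth /comp tpermK.
by move=> x y; rewrite !DE => /S_inj /perm_inj.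
Qed.

Lemma n_faces_smooth (D_inj : injective (@turn_left D)) :
  n_faces S + (~~ fconnect (@turn_left D) (f R, false) (R, true)).*2
  = (n_faces D).+1.
Proof.
apply: (fcard_comp_tperm (g := @turn_left S) D_inj _ turn_left_smooth).
by rewrite xpair_eqE andbF.
Qed.

(** The transposition is an involution, so the faces of [D] arise from those of [S] in the same way.
    The case distinction is now on a face of [S]. *)
Lemma n_faces_smooth_rev (D_inj : injective (@turn_left S)) :
  n_faces D + (~~ fconnect (@turn_left S) (f R, false) (R, true)).*2
  = (n_faces S).+1.
Proof.
apply: (fcard_comp_tperm (g := @turn_left D) D_inj) => [|d].
  by rewrite xpair_eqE andbF.
by rewrite /comp turn_left_smooth /comp tpermK.
Qed.

Lemma adjacent_smooth_connect e e' :
  adjacent (e : edge S) (e' : edge S) -> connect (@adjacent D) e e'.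
Proof.
have sym := @connect_adjacent_sym D.
have cf e0 : connect (@adjacent D) e0 (follow S e0).
  have [->|xL] := eqVneq e0 L.
    rewrite follow_smooth_left.
    exact: connect_trans (connect_left_right c) (connect_follow _).
  have [->|xR] := eqVneq e0 R.
    rewrite follow_smooth_right.
    apply: connect_trans (connect_follow _).
    by rewrite sym connect_left_right.
  by rewrite follow_smooth_other // connect_follow.
case/or3P => [/eqP->|/eqP->|/existsP[x Hx]] //; first by rewrite sym.
apply: connect1; apply/or3P; constructor 3; apply/existsP.
by exists (val x).
Qed.

(** Since [follow S] leads from [L] to [f R] and from [R] to [f L], each lost adjacency is recovered
    by one jump between [L] and [R]. *)
Lemma adjacent_connect_smooth e e' :
  adjacent (e : edge D) (e' : edge D) ->
  [|| connect (@adjacent S) e e',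
      connect (@adjacent S) e L && connect (@adjacent S) R e'
    | connect (@adjacent S) e R && connect (@adjacent S) L e'].
Proof.
have sym := @connect_adjacent_sym S.
have cLR : connect (@adjacent S) L (f R).
  by rewrite -follow_smooth_left connect_follow.
have cRL : connect (@adjacent S) R (f L).
  by rewrite -follow_smooth_right connect_follow.
case/or3P => [/eqP->|/eqP->|/existsP[x Hx]].
- have [->|eL] := eqVneq e L; first by rewrite cRL connect0 orbT.
  have [->|eR] := eqVneq e R; first by rewrite cLR connect0 !orbT.
  by rewrite -follow_smooth_other // connect_follow.
- have [->|eL] := eqVneq e' L.
    by rewrite (sym (f L) R) cRL connect0 !orbT.
  have [->|eR] := eqVneq e' R.
    by rewrite (sym (f R) L) cLR connect0 !orbT.
  by rewrite -follow_smooth_other // sym connect_follow.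
have [xc|xc] := eqVneq x c.
  have : ((e == L) && (e' == R)) || ((e == R) && (e' == L)).
    move: Hx; rewrite xc /L /R /left_in /right_in.
    rewrite [(e' == _) && _]andbC.
    by case: (positive D c); rewrite // orbC.
  by case/orP => /andP[/eqP-> /eqP->]; rewrite !connect0 ?orbT.
apply/or3P; constructor 1; apply: connect1; apply/or3P; constructor 3.
by apply/existsP; exists (Sub x xc).
Qed.

Lemma n_pieces_smooth_le : n_pieces S <= (n_pieces D).+1.
Proof.
exact: (n_comp_add_edge (@connect_adjacent_sym D) (@connect_adjacent_sym S)
  adjacent_connect_smooth).
Qed.

Lemma n_pieces_smooth_connected :
  connect (@adjacent S) L R -> n_pieces S = n_pieces D.
Proof.
move=> cLR; apply: eq_n_comp => e e'; apply/idP/idP.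
  apply: connect_sub => x y; exact: adjacent_smooth_connect.
apply: connect_sub => x y /adjacent_connect_smooth /or3P[//|/andP[]|/andP[]].
  by move=> xL; apply: connect_trans; apply: connect_trans xL cLR.
move=> xR; apply: connect_trans; apply: connect_trans xR _.
by rewrite connect_adjacent_sym.
Qed.

(* If the two strands at c belong to different pieces after the smoothing, no
   face of the smoothed diagram can touch both of them. *)
Lemma n_faces_smooth_disconnected (S_inj : injective (@turn_left S)) :
  ~~ connect (@adjacent S) L R -> (n_faces D).+1 = n_faces S.
Proof.
move=> nLR; apply: succn_inj; rewrite -n_faces_smooth_rev //.
suff -> : fconnect (@turn_left S) (f R, false) (R, true) = false.
  by rewrite /=; lia.
(* In [S] the edge [f R] follows [L], so it lies in the piece of [L]. *)
apply: contraNF nLR => /fconnect_turn_left /= fRR.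
apply: connect_trans (fRR smooth_proper).
rewrite -follow_smooth_left; exact: connect_follow.
Qed.

End Smoothing.

(** * Euler's formula under smoothing and crossing change *)

Lemma no_crossing_turn_left (D : gauss_data) (e : edge D) b :
  #|crossing D| = 0 ->
  turn_left (e, b) = if b then (follow D e, true)
                     else ((follow D)^-1%g e, false).
Proof.
move=> D0; have pick0 (P : pred (crossing D)) : [pick x | P x] = None.
  by case: pickP => // x; have := fintype0 x D0.
by rewrite /=; case: b; rewrite !pick0.
Qed.

(** Each smoothing only composes [turn_left] with a transposition, which reduces the claim to
    diagrams without crossings, where the inverse is explicit. *)
Lemma turn_left_inj (D : gauss_data) :
  proper_passages D -> injective (@turn_left D).
Proof.
move: {2}#|_| (erefl #|crossing D|) => n; elim: n D => [|n IHn] D Dn D_proper.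
  have K : cancel (@turn_left D)
      (fun d => if d.2 then ((follow D)^-1%g d.1, true)
                else (follow D d.1, false)).
    by case=> e []; rewrite no_crossing_turn_left //= ?permK ?permKV.
  exact: can_inj K.
have /card_gt0P[c _] : 0 < #|crossing D| by rewrite Dn.
apply: (turn_left_smooth_inj D_proper (c := c)).
apply: IHn; last exact: smooth_proper.
by rewrite /= card_sub (cardC1 c) Dn.
Qed.

(** Here the pieces are the cycles of [follow], each with at most two faces, one per direction of
    travel. *)
Lemma euler_no_crossing (D : gauss_data) :
  #|crossing D| = 0 -> n_vertices D + n_faces D <= #|edge D| + 2 * n_pieces D.
Proof.
move=> D0; have sym_f := fconnect_sym (@perm_inj _ (follow D)).
have adjacent_fconnect e e' : adjacent e e' -> fconnect (follow D) e e'.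
  case/or3P => [/eqP->|/eqP->|/existsP[x]]; first exact: fconnect1.
    by rewrite sym_f fconnect1.
  by have := fintype0 x D0.
have sym_t : connect_sym (frel (@turn_left D)).
  apply: fconnect_sym; apply: turn_left_inj; split=> x;
  by have := fintype0 x D0.
have turn_fconnect e b n :
    fconnect (@turn_left D) (e, b) (iter n (follow D) e, b).
  elim: n => //= n IHn; apply: connect_trans IHn _; case: b.
    rewrite -[X in fconnect _ _ X](no_crossing_turn_left _ true) //.
    exact: fconnect1.
  (* Faces run backwards go against [follow], so the step is taken from its other end. *)
  rewrite sym_t; set e' := iter _ _ _.
  have <- : turn_left (follow D e', false) = (e', false).
    by rewrite no_crossing_turn_left // permK.
  exact: fconnect1.
apply: leq_add.
  rewrite /n_vertices D0 add0n; exact: max_card.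
have -> : n_pieces D = #|[set e | roots (@adjacent D) e]|.
  by apply: eq_card => e; rewrite !inE andbT.
have -> : n_faces D = #|[set d | froots (@turn_left D) d]|.
  by apply: eq_card => e; rewrite !inE andbT.
(* A face is determined by its piece and its direction, so [g] is injective on representatives of
   faces. *)
pose g (d : edge D * bool) := (root (@adjacent D) d.1, d.2).
rewrite -(@card_in_imset _ _ g) => [|[e b] [e' b']].
  rewrite mulnC -card_bool -cardsT -cardsX; apply: subset_leq_card.
  apply/subsetP => _ /imsetP[d _ ->]; rewrite !inE andbT.
  exact: roots_root (@connect_adjacent_sym D) _.
rewrite !inE => /eqP re /eqP re' [/eqP].
rewrite (root_connect (@connect_adjacent_sym D)) => ee' bb'.
rewrite -{}bb' in re' *; rewrite -re -re'; apply/(rootP sym_t).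
have /iter_findex <- : fconnect (follow D) e e'.
  by apply: connect_sub ee' => x y /adjacent_fconnect.
exact: turn_fconnect.
Qed.

(** If [L] and [R] stay connected, K is unchanged and the vertex gained makes up for a face possibly
    lost. Otherwise V and F both go up by one, and K by at most one. *)
Lemma euler_le (D : gauss_data) :
  proper_passages D ->
  n_vertices D + n_faces D <= #|edge D| + 2 * n_pieces D.
Proof.
move: {2}#|_| (erefl #|crossing D|) => n; elim: n D => [|n IHn] D Dn D_proper.
  exact: euler_no_crossing.
have /card_gt0P[c _] : 0 < #|crossing D| by rewrite Dn.
have S_proper := smooth_proper c D_proper.
have S_inj := turn_left_inj S_proper.
have := IHn (smooth_crossing c) _ S_proper.
rewrite (n_vertices_smooth c D_proper) [edge _]/= card_sub (cardC1 c) Dn.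
move=> /(_ erefl).
case: (boolP (connect (@adjacent (smooth_crossing c)) (left_in c) (right_in c)))
  => cLR.
  rewrite (n_pieces_smooth_connected cLR).
  have := n_faces_smooth_rev D_proper S_inj; lia.
have := n_faces_smooth_disconnected D_proper S_inj cLR.
have := n_pieces_smooth_le c; lia.
Qed.

Lemma smooth_planar (D : gauss_data) (c : crossing D) :
  proper_passages D -> planar D -> planar (smooth_crossing c).
Proof.
move=> D_proper; rewrite /planar => D_planar.
have S_proper := smooth_proper c D_proper.
have S_inj := turn_left_inj S_proper.
have := euler_le S_proper.
have := n_faces_smooth c D_proper (turn_left_inj D_proper).
have := n_pieces_smooth_le c.
have -> : #|edge (smooth_crossing c)| = #|edge D| by [].
rewrite (n_vertices_smooth c D_proper).
case: (boolP (connect (@adjacent (smooth_crossing c)) (left_in c) (right_in c)))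
  => cLR.
  (* K is unchanged, so a rise of F would violate [euler_le]. Hence F drops by one, cancelling the
     new vertex. *)
  rewrite (n_pieces_smooth_connected cLR).
  move: D_planar; case: (fconnect _ _ _) => /=; lia.
(* V and F both rise by one, so [euler_le] forces K up, and it rises by exactly one. *)
have := n_faces_smooth_disconnected D_proper S_inj cLR.
move: D_planar; case: (fconnect _ _ _) => /=; lia.
Qed.

Lemma change_proper (D : gauss_data) (c : crossing D) :
  proper_passages D -> proper_passages (change_crossing c).
Proof.
case=> o_inj u_inj ou; split=> x y /=.
- by do 2![case: eqP => [->|_]] => // E;
    [case: (ou _ _ (esym E)) | case: (ou _ _ E) | exact: o_inj].
- by do 2![case: eqP => [->|_]] => // E;
    [case: (ou _ _ E) | case: (ou _ _ (esym E)) | exact: u_inj].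
case: eqP => [->|nx]; case: eqP => [->|ny] E.
- by case: (ou _ _ (esym E)).
- by move/u_inj: E => E; case: ny.
- by move/o_inj: E => E; case: nx.
by case: (ou _ _ E).
Qed.

(* Exchanging the strands and the sign leaves the lower left and lower right
   edges, hence the underlying plane graph, untouched. *)
Lemma change_left_in (D : gauss_data) (c : crossing D) :
  @left_in (change_crossing c) =1 @left_in D.
Proof. by move=> x; rewrite /left_in /=; case: eqP; case: (positive D x). Qed.

Lemma change_right_in (D : gauss_data) (c : crossing D) :
  @right_in (change_crossing c) =1 @right_in D.
Proof. by move=> x; rewrite /right_in /=; case: eqP; case: (positive D x). Qed.

Lemma change_plain (D : gauss_data) (c : crossing D) (e : edge D) :
  plain (e : edge (change_crossing c)) = plain (e : edge D).
Proof.
rewrite !plainE; apply: eq_forallb => x.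
by rewrite change_left_in change_right_in.
Qed.

Lemma change_turn_left (D : gauss_data) (c : crossing D) :
  @turn_left (change_crossing c) =1 @turn_left D.
Proof.
have pick_left_in (e : edge D) :
    [pick x | @left_in (change_crossing c) x == e]
    = [pick x | @left_in D x == e].
  by apply: eq_pick => x; rewrite change_left_in.
have pick_right_in (e : edge D) :
    [pick x | @right_in (change_crossing c) x == e]
    = [pick x | @right_in D x == e].
  by apply: eq_pick => x; rewrite change_right_in.
case=> e []; rewrite /turn_left pick_left_in pick_right_in;
  by do 2?[case: pick => [x|]]; rewrite ?change_left_in ?change_right_in.
Qed.

Lemma change_planar (D : gauss_data) (c : crossing D) :
  planar D -> planar (change_crossing c).
Proof.
rewrite /planar; set D' := change_crossing c.
have -> : n_vertices D' = n_vertices D.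
  congr (_ + _); apply: eq_card => e; by rewrite !inE change_plain.
have -> : n_faces D' = n_faces D.
  apply: eq_n_comp; apply: eq_connect => d d'.
  by rewrite /frel /= change_turn_left.
have -> //: n_pieces D' = n_pieces D.
apply: eq_n_comp; apply: eq_connect => e e'; congr [|| _, _ | _].
apply: eq_existsb => x /=; case: (x == c) => //.
by rewrite orbC; congr (_ || _); rewrite andbC.
Qed.

(** * The arc of the skein triple *)

Section Skein.
Variables (D : marked_diagram) (c : crossing D).
Hypothesis D_proper : proper_passages D.
Hypothesis D_arc : is_overarc D.
Hypothesis c_terminates : terminates c.
Local Notation f := (follow D).

(** The walk reaches [under_in D c] for the first time at its end, so it is shorter than one turn
    round the component. Therefore [findex] counts its steps exactly and no passage repeats. *)
Lemma skein_arc :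
  exists2 m, all (@plain D) (traject f (arc_end D) m)
    & traject f (base D) (steps_through c)
      = rcons (arc_passages D ++ traject f (arc_end D) m) (under_in D c)
      /\ uniq (traject f (base D) (steps_through c)).
Proof.
have [_ c_off [m m_plain mE]] := c_terminates; have [_ no_under] := D_arc.
exists m => //.
have trajE : traject f (base D) (steps D + m)
    = arc_passages D ++ traject f (arc_end D) m by rewrite trajectD.
have iterE : iter (steps D + m) f (base D) = under_in D c.
  by rewrite addnC iterD.
have nE : under_in D c \notin traject f (base D) (steps D + m).
  rewrite trajE mem_cat (negbTE (no_under c)) /=.
  apply/negP => /(allP m_plain) /forallP/(_ c).
  by rewrite eqxx andbF.
have lt_order : steps D + m < fingraph.order f (base D).
  by apply: iter_traject_lt; rewrite iterE.
have stE : steps_through c = (steps D + m).+1.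
  by rewrite /steps_through -iterE findex_iter.
rewrite stE trajectSr trajE iterE; split=> //.
(* The walk is an initial segment of the duplicate-free listing of the whole cycle. *)
rewrite -iterE -trajE -trajectSr.
have := orbit_uniq f (base D); rewrite /fingraph.orbit -(subnKC lt_order).
by rewrite trajectD cat_uniq => /andP[].
Qed.

(** After the crossing change this edge is the underpass of [c], which the new arc must avoid. *)
Lemma over_in_notin_skein_arc :
  over_in D c \notin traject f (base D) (steps_through c).
Proof.
have [_ c_off _] := c_terminates; have [m m_plain [-> _]] := skein_arc.
have [_ _ ou] := D_proper.
rewrite mem_rcons inE mem_cat !negb_or.
move: c_off; rewrite negb_or => /andP[-> _].
rewrite (introN eqP (ou c c)) /=.
by apply/negP => /(allP m_plain) /forallP/(_ c); rewrite eqxx.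
Qed.

Lemma under_in_notin_skein_arc x :
  x != c -> under_in D x \notin traject f (base D) (steps_through c).
Proof.
have [m m_plain [-> _]] := skein_arc.
have [_ u_inj _] := D_proper; have [_ no_under] := D_arc.
move=> xc; rewrite mem_rcons inE mem_cat (inj_eq u_inj) (negbTE xc).
rewrite (negbTE (no_under x)) /=.
by apply/negP => /(allP m_plain) /forallP/(_ x); rewrite eqxx andbF.
Qed.

Lemma arc_sub_skein_arc :
  {subset arc_passages D <= traject f (base D) (steps_through c)}.
Proof.
have [m _ [-> _]] := skein_arc; move=> e eD.
by rewrite mem_rcons inE mem_cat eD orbT.
Qed.

Lemma under_in_skein_arc :
  under_in D c \in traject f (base D) (steps_through c).
Proof. by have [m _ [-> _]] := skein_arc; rewrite mem_rcons inE eqxx. Qed.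

(** Smoothing redirects only the two passages of [c]: the overpass is off the walk, and the
    underpass is its last entry, whose continuation is not listed. *)
Lemma skein_zero_arc :
  arc_passages (skein_zero c) = traject f (base D) (steps_through c).
Proof.
apply: esym; apply: eq_traject => e e_in.
have [m m_plain [trajE tr_uniq]] := skein_arc.
have e_arc : e \in arc_passages D ++ traject f (arc_end D) m.
  have : rcons (traject f (base D) (steps_through c).-1)
               (iter (steps_through c).-1 f (base D))
       = rcons (arc_passages D ++ traject f (arc_end D) m) (under_in D c).
    by rewrite -trajE -trajectSr.
  by move/rcons_inj => [<- _].
rewrite permM tpermD //.
  apply: contraNneq over_in_notin_skein_arc => ->.
  by rewrite trajE mem_rcons inE e_arc orbT.
move: tr_uniq; rewrite trajE rcons_uniq => /andP[u_notin _].
by apply: contraNneq u_notin => ->.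
Qed.

End Skein.

(** * Almost positivity and complexity of the skein triple *)

Lemma skein_minus_weakly_successively_almost_positive
    (D : marked_diagram) (c : crossing D) :
  weakly_successively_almost_positive D -> terminates c ->
  weakly_successively_almost_positive (skein_minus c).
Proof.
case=> k [[D_proper D_planar] D_arc _ neg_arc] c_term.
(* The witness is simply the number of negative crossings of the new diagram. *)
eexists; split; [split | | reflexivity |].
- exact: change_proper.
- exact: change_planar.
- split; first by have [m _ []] := skein_arc D_arc c_term.
  move=> x /=; case: eqP => [->|/eqP xc].
    exact: over_in_notin_skein_arc.
  exact: under_in_notin_skein_arc.
move=> x /=; case: eqP => [-> _|_ x_neg]; first exact: under_in_skein_arc.
exact: arc_sub_skein_arc (neg_arc x x_neg).
Qed.

Lemma skein_zero_weakly_successively_almost_positive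
    (D : marked_diagram) (c : crossing D) :
  weakly_successively_almost_positive D -> terminates c ->
  weakly_successively_almost_positive (skein_zero c).
Proof.
case=> k [[D_proper D_planar] D_arc _ neg_arc] c_term.
have arcE := skein_zero_arc D_proper D_arc c_term.
eexists; split; [split | | reflexivity |].
- exact: smooth_proper.
- exact: smooth_planar.
- split; first by rewrite arcE; have [m _ []] := skein_arc D_arc c_term.
  by move=> x; rewrite arcE; apply: under_in_notin_skein_arc (valP x).
move=> x x_neg; rewrite arcE.
exact: arc_sub_skein_arc (neg_arc (val x) x_neg).
Qed.

Lemma complexity_skein_zero (D : marked_diagram) (c : crossing D) :
  (complexity (skein_zero c) < complexity D)%O.
Proof.
have lt_c : n_crossings (skein_zero c) < n_crossings D.
  rewrite /n_crossings /= card_sub (cardC1 c) prednK //.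
  by apply/card_gt0P; exists c.
by rewrite Order.ProdLexiOrder.ltEprodlexi /= leEnat (ltnW lt_c) leqNgt lt_c.
Qed.

Lemma complexity_skein_minus (D : marked_diagram) (c : crossing D) :
  is_overarc D -> terminates c ->
  (complexity (skein_minus c) < complexity D)%O.
Proof.
move=> D_arc c_term; have [_ c_off _] := c_term.
rewrite Order.ProdLexiOrder.ltEprodlexi /= !leEnat ltEnat /= leqnn /=.
have lt_arc : n_arc_crossings D < n_arc_crossings (skein_minus c).
  apply: proper_card; apply/properP; split; last first.
    exists c; rewrite !inE //.
    by rewrite /on_arc /= eqxx under_in_skein_arc.
  apply/subsetP => x; rewrite !inE /on_arc.
  have sub := arc_sub_skein_arc D_arc c_term.
  (* At [x = c] the two passages are exchanged, but [on_arc] is symmetric in them. *)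
  case/orP=> /sub x_in; rewrite /arc_passages /=; case: (x == c);
  by rewrite x_in ?orbT.
(* For the truncated differences to be strictly ordered, the old arc must miss some crossing, which
   follows from [lt_arc]. *)
rewrite ltn_sub2l //; apply: leq_trans lt_arc _; exact: max_card.
Qed.

Theorem theorem5p4 (D D0 Dm : marked_diagram)
  (hD : weakly_successively_almost_positive D)
  (hskein : standard_skein_triple D D0 Dm) :
  [/\ weakly_successively_almost_positive Dm,
      weakly_successively_almost_positive D0,
      (complexity D0 < complexity D)%O
    & (complexity Dm < complexity D)%O].
Proof.
case: hskein => c [c_term -> ->]; split.
- exact: skein_minus_weakly_successively_almost_positive.
- exact: skein_zero_weakly_successively_almost_positive.
- exact: complexity_skein_zero.
by case: hD => k [_ D_arc _ _]; exact: complexity_skein_minus.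
Qed.
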